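(* Let $f:\mathbb{R}^n\to\mathbb{R}$ be convex and twice differentiable, and let $H>0$ be such that $\|\nabla f(y)-\nabla f(x)-\nabla^2 f(x)(y-x)\|\le H\|y-x\|^2$ for all $x,y\in\mathbb{R}^n$. Suppose that for every $z\in\mathbb{R}^n$ the sublevel set $\mathcal{L}(z)=\{x\in\mathbb{R}^n: f(x)\le f(z)\}$ is bounded. Let $\{x_k\}$, $\{\sigma_k\}$ be generated by Algorithm 1 (described in the context) with parameters $x_1\in\mathbb{R}^n$, $\sigma_1>0$, $\alpha\in(0,1]$, $\theta\in(0,1)$, $\zeta>2$, $\kappa_B>0$, and suppose that the matrices $B_{k,i}$ computed by the algorithm satisfy $$\|B_{k,i}-\nabla^2 f(x_k)\|\le \kappa_B\sqrt{\|\nabla f(x_k)\|^{\alpha}}.$$ Let $M>0$ be a constant such that $\|\nabla f(x)\|\le M$ for all $x\in\mathcal{L}(x_1)$. Then for all $k=1,2,\ldots$ $$\sigma_1\le\sigma_k\le \sigma_{\max}:=2\max\{4\kappa_B^2,\ \hat\sigma_1(M),\ \hat\sigma_2(M)\}+\sigma_1 .$$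
   Context: Norms are Euclidean for vectors and spectral for matrices; $\mathcal{I}$ is the identity matrix and $e_1,\dots,e_n$ is the standard basis. For $g\ge 0$ define $$\hat\sigma_1(g)=\left(\frac{\zeta}{2(\zeta-1)}\left[\kappa_B+\sqrt{\kappa_B^2+\frac{4(\zeta-1)}{\zeta}Hg^{1-\alpha}}\right]\right)^2,\qquad \hat\sigma_2(g)=\left(\frac{\kappa_B+\sqrt{\kappa_B^2+\frac{4H}{3}g^{1-\alpha}\left(\frac12-\frac1\zeta\right)}}{1-\frac2\zeta}\right)^2 .$$ Algorithm 1. Step 0: Given $x_1\in\mathbb{R}^n$, $\sigma_1>0$, $\alpha\in(0,1]$, $\theta\in(0,1)$, $\zeta>2$, $\kappa_B>0$, set $k:=1$. Step 1: Find the smallest integer $i\ge 0$ such that $2^i\sigma_k\ge 2\sigma_1$. Step 1.1: Define $$\lambda_{k,i}=\max\left\{[2(1+\theta)]^{\alpha/2}\sqrt{2^i\sigma_k\|\nabla f(x_k)\|^\alpha},\ \zeta\theta\right\},\qquad h_i=\frac{\kappa_B\sqrt{\|\nabla f(x_k)\|^\alpha}}{4\sqrt n\,(2^i\sigma_k)},$$ let $A_{k,i}\in\mathbb{R}^{n\times n}$ be the matrix whose $j$-th column is $\frac{\nabla f(x_k+h_ie_j)-\nabla f(x_k)}{h_i}$, let $B_{k,i}=\frac12(A_{k,i}+A_{k,i}^T)$, and compute a point $x^+$ satisfying $$\|(B_{k,i}+\lambda_{k,i}\mathcal{I})(x^+-x_k)+\nabla f(x_k)\|\le\theta\min\{\|\nabla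 f(x_k)\|,\|x^+-x_k\|\}.$$ Step 1.2: If both $f(x^+)\le f(x_k)-\frac{\lambda_{k,i}}{2}\|x^+-x_k\|^2$ and $\|\nabla f(x^+)\|\le 2\lambda_{k,i}\|x^+-x_k\|$ hold, set $i_k=i$ and go to Step 2. Otherwise set $i:=i+1$ and go to Step 1.1. Step 2: Set $x_{k+1}=x^+$, $\sigma_{k+1}=2^{i_k-1}\sigma_k$, $k:=k+1$ and go to Step 1. (The finite differences require $h_i>0$, i.e. iterations are performed at points with $\nabla f(x_k)\ne 0$.) *)

(* Defs.v *)
From HB Require Import structures.
From mathcomp Require Import all_boot all_order all_algebra.
From mathcomp Require Import all_classical all_reals all_analysis.

Set Implicit Arguments.
Unset Strict Implicit.
Unset Printing Implicit Defensive.

Import Order.TTheory GRing.Theory Num.Theory.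
Import numFieldNormedType.Exports.

Local Open Scope classical_set_scope.
Local Open Scope ring_scope.

(* R^n is 'cV[R]_n. The library norm on matrices is the max-norm; since all norms
   on R^n are equivalent, [differentiable], ['D_v] and [bounded_set] below do not
   depend on this choice. The Euclidean and spectral norms, which enter the
   inequalities, are defined explicitly. *)

Definition enorm (R : realType) (n : nat) (v : 'cV[R]_n) : R :=
  Num.sqrt (\sum_(j < n) v j 0 ^+ 2).

(* The set is bounded and contains 0, so that this [sup] is a true supremum. *)
Definition specnorm (R : realType) (n : nat) (A : 'M[R]_n) : R :=
  sup [set enorm (A *m v) | v in [set v : 'cV[R]_n | enorm v <= 1]].

Definition basis_vec (R : realType) (n : nat) (j : 'I_n) : 'cV[R]_n :=
  delta_mx j 0.

Definition grad (R : realType) (n : nat) (f : 'cV[R]_n -> R) (x : 'cV[R]_n) :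
    'cV[R]_n :=
  \col_(j < n) 'D_(basis_vec R j) f x.

Definition hess (R : realType) (n : nat) (f : 'cV[R]_n -> R) (x : 'cV[R]_n) :
    'M[R]_n :=
  \matrix_(i < n, j < n) 'D_(basis_vec R j) (fun y => grad f y i 0) x.

Definition twice_differentiable (R : realType) (n : nat) (f : 'cV[R]_n -> R) :
    Prop :=
  (forall x, differentiable f x) /\ (forall x, differentiable (grad f) x).

Definition convex_on_space (R : realType) (n : nat) (f : 'cV[R]_n -> R) : Prop :=
  convex_function [set: convex_lmodType 'cV[R]_n] f.

Definition sublevel (R : realType) (n : nat) (f : 'cV[R]_n -> R)
    (z : 'cV[R]_n) : set 'cV[R]_n :=
  [set x | f x <= f z].

Definition sigma_hat1 (R : realType) (alpha zeta kappaB H g : R) : R :=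
  (zeta / (2 * (zeta - 1)) *
    (kappaB + Num.sqrt (kappaB ^+ 2 +
       4 * (zeta - 1) / zeta * H * g `^ (1 - alpha)))) ^+ 2.

Definition sigma_hat2 (R : realType) (alpha zeta kappaB H g : R) : R :=
  ((kappaB + Num.sqrt (kappaB ^+ 2 +
       4 * H / 3 * g `^ (1 - alpha) * (1 / 2 - 1 / zeta)))
   / (1 - 2 / zeta)) ^+ 2.

(* In the next definitions [x] is the current point x_k and [s] is the trial
   value 2^i sigma_k, so that lambda_{k,i}, h_i and B_{k,i} are obtained with
   s := 2 ^+ i * sigma k. *)

Definition trial_lambda (R : realType) (n : nat) (f : 'cV[R]_n -> R)
    (alpha theta zeta : R) (x : 'cV[R]_n) (s : R) : R :=
  Num.max ((2 * (1 + theta)) `^ (alpha / 2) *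
             Num.sqrt (s * enorm (grad f x) `^ alpha))
          (zeta * theta).

Definition trial_h (R : realType) (n : nat) (f : 'cV[R]_n -> R)
    (alpha kappaB : R) (x : 'cV[R]_n) (s : R) : R :=
  kappaB * Num.sqrt (enorm (grad f x) `^ alpha) / (4 * Num.sqrt n%:R * s).

Definition fd_matrix (R : realType) (n : nat) (f : 'cV[R]_n -> R)
    (x : 'cV[R]_n) (h : R) : 'M[R]_n :=
  \matrix_(l < n, j < n)
    (h^-1 *: (grad f (x + h *: basis_vec R j) - grad f x)) l 0.

Definition trial_B (R : realType) (n : nat) (f : 'cV[R]_n -> R)
    (alpha kappaB : R) (x : 'cV[R]_n) (s : R) : 'M[R]_n :=
  let A := fd_matrix f x (trial_h f alpha kappaB x s) in
  (1 / 2) *: (A + A^T).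

Definition inexact_step (R : realType) (n : nat) (f : 'cV[R]_n -> R)
    (alpha theta zeta kappaB : R) (x : 'cV[R]_n) (s : R) (xp : 'cV[R]_n) : bool :=
  enorm ((trial_B f alpha kappaB x s + (trial_lambda f alpha theta zeta x s)%:M)
           *m (xp - x) + grad f x)
    <= theta * Num.min (enorm (grad f x)) (enorm (xp - x)).

Definition acceptable (R : realType) (n : nat) (f : 'cV[R]_n -> R)
    (alpha theta zeta : R) (x : 'cV[R]_n) (s : R) (xp : 'cV[R]_n) : bool :=
  let lam := trial_lambda f alpha theta zeta x s in
  (f xp <= f x - lam / 2 * enorm (xp - x) ^+ 2) &&
  (enorm (grad f xp) <= 2 * lam * enorm (xp - x)).

(* One pass through Steps 1-2, from the pair (x, sigma) to (x', sigma'): [i0] is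
   the first inner index, [ik] the accepted one, and [xp i] the trial point
   computed at inner index [i], for i0 <= i <= ik. *)
Record iteration (R : realType) (n : nat) (f : 'cV[R]_n -> R)
    (alpha theta zeta kappaB sigma1 : R) (x : 'cV[R]_n) (sigma : R)
    (i0 ik : nat) (xp : nat -> 'cV[R]_n) (x' : 'cV[R]_n) (sigma' : R) : Prop :=
  Iteration {
    iter_nonstationary : grad f x != 0;
    iter_start : 2 * sigma1 <= 2 ^+ i0 * sigma;
    iter_start_least : forall i, (i < i0)%N -> 2 ^+ i * sigma < 2 * sigma1;
    iter_start_le : (i0 <= ik)%N;
    iter_trial : forall i, (i0 <= i <= ik)%N ->
      inexact_step f alpha theta zeta kappaB x (2 ^+ i * sigma) (xp i);
    iter_reject : forall i, (i0 <= i < ik)%N ->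
      ~~ acceptable f alpha theta zeta x (2 ^+ i * sigma) (xp i);
    iter_accept : acceptable f alpha theta zeta x (2 ^+ ik * sigma) (xp ik);
    iter_next : x' = xp ik;
    iter_sigma : sigma' = 2 ^ (ik%:Z - 1) * sigma
  }.

(* Indices start at 1. A run consists of [m] iterations when N = Some m (e.g. when
   x_(m+1) is stationary, where no further iteration is possible), and of
   infinitely many when N = None. *)
Definition generated (N : option nat) (k : nat) : bool :=
  (0 < k)%N && (if N is Some m then (k <= m.+1)%N else true).

Definition performed (N : option nat) (k : nat) : bool :=
  (0 < k)%N && generated N k.+1.

Record algorithm1_run (R : realType) (n : nat) (f : 'cV[R]_n -> R)
    (alpha theta zeta kappaB : R) (x1 : 'cV[R]_n) (sigma1 : R) (N : option nat)
    (x : nat -> 'cV[R]_n) (sigma : nat -> R) (i0 ik : nat -> nat)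
    (xp : nat -> nat -> 'cV[R]_n) : Prop :=
  Algorithm1Run {
    run_x1 : x 1%N = x1;
    run_sigma1 : sigma 1%N = sigma1;
    run_iteration : forall k, performed N k ->
      iteration f alpha theta zeta kappaB sigma1 (x k) (sigma k)
        (i0 k) (ik k) (xp k) (x k.+1) (sigma k.+1)
  }.

(* Main.v *)
Require Import Defs.
From HB Require Import structures.
From mathcomp Require Import all_boot all_order all_algebra.
From mathcomp Require Import all_classical all_reals all_analysis.
From mathcomp Require Import ring lra.

Set Implicit Arguments.
Unset Strict Implicit.
Unset Printing Implicit Defensive.

Import Order.TTheory GRing.Theory Num.Theory.
Import numFieldNormedType.Exports.

Local Open Scope classical_set_scope.
Local Open Scope ring_scope.

(** The theorem reduces to one fact about a single trial: as soon as the trial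
    value s satisfies s >= 2 sigma_hat2(M), the trial point passes both
    acceptance tests ([trial_acceptable]).  The bounds on sigma_k follow by
    induction.  If the inner loop rejected at least one trial, the new sigma is
    the last rejected trial value, hence is below 2 sigma_hat2(M), which is at
    most sigma_max.  If the first trial was accepted, minimality of its index
    together with sigma_k >= sigma_1 forces that index to be 0 or 1, so sigma
    does not grow.  The accepted value is at least 2 sigma_1 and gets halved,
    whence sigma_1 <= sigma_(k+1).  The objective decreases along the run, so
    every iterate stays in L(x_1) and its gradient is bounded by M.

    For a single trial, write d for the step, G for the gradient norm at x,
    a = sqrt (G^alpha), w = 1/2 - 1/zeta, E = w lambda - kappa_B a and
    Delta = E + lambda/2.  Since theta <= lambda/zeta, three estimates on the
    inexact regularized Newton step hold:
    - Delta |d| <= G, because the Hessian of a convex function is positive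
      semidefinite ([hess_psd], [inexact_step_length]);
    - the decrease test follows from H |d| / 3 <= E, by a second-order Taylor
      bound with cubic remainder ([taylor_quadratic_le],
      [inexact_step_decrease]);
    - the gradient test follows from H |d| <= Delta ([inexact_step_grad]).
    Thus it suffices that H G <= 3 E Delta and H G <= Delta^2.  The number
    t = sqrt (sigma_hat2 M) is the nonnegative root of
    w t^2 - kappa_B t = H M^(1-alpha) / 3, and lambda >= a sqrt s with
    s >= 2 t^2.  The factor 2 yields (w sqrt s - kappa_B) sqrt s >=
    2/3 H M^(1-alpha) ([sigma_hat2_threshold]), from which both inequalities
    are elementary algebra ([step_length_small]). *)

(** * Euclidean geometry of column vectors *)

Definition dotv (R : realType) (n : nat) (u v : 'cV[R]_n) : R :=
  \sum_(j < n) u j 0 * v j 0.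

Section Euclidean.
Variables (R : realType) (n : nat).
Implicit Types (u v w : 'cV[R]_n) (A : 'M[R]_n) (c : R).

Lemma dotvC u v : dotv u v = dotv v u.
Proof. by apply: eq_bigr => j _; rewrite mulrC. Qed.

Lemma dotvDr u v w : dotv u (v + w) = dotv u v + dotv u w.
Proof. by rewrite -big_split; apply: eq_bigr => j _; rewrite mxE mulrDr. Qed.

Lemma dotvZr c u v : dotv u (c *: v) = c * dotv u v.
Proof. by rewrite mulr_sumr; apply: eq_bigr => j _; rewrite mxE mulrCA. Qed.

Lemma dotvNr u v : dotv u (- v) = - dotv u v.
Proof. by rewrite -scaleN1r dotvZr mulN1r. Qed.

Lemma dotvBr u v w : dotv u (v - w) = dotv u v - dotv u w.
Proof. by rewrite dotvDr dotvNr. Qed.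

Lemma dotvDl u v w : dotv (u + v) w = dotv u w + dotv v w.
Proof. by rewrite dotvC dotvDr !(dotvC w). Qed.

Lemma dotvZl c u v : dotv (c *: u) v = c * dotv u v.
Proof. by rewrite dotvC dotvZr dotvC. Qed.

Lemma dotvNl u v : dotv (- u) v = - dotv u v.
Proof. by rewrite dotvC dotvNr dotvC. Qed.

Lemma dotvv_ge0 u : 0 <= dotv u u.
Proof. by apply: sumr_ge0 => j _; rewrite -expr2 sqr_ge0. Qed.

Lemma enormE u : enorm u = Num.sqrt (dotv u u).
Proof. by congr Num.sqrt; apply: eq_bigr => j _; rewrite expr2. Qed.

Lemma enorm_ge0 u : 0 <= enorm u.
Proof. exact: sqrtr_ge0. Qed.

Lemma sqr_enorm u : enorm u ^+ 2 = dotv u u.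
Proof. by rewrite enormE sqr_sqrtr// dotvv_ge0. Qed.

Lemma enorm0_eq0 u : enorm u = 0 -> u = 0.
Proof.
move=> u0; have /eqP := sqr_enorm u; rewrite u0 expr0n/= eq_sym psumr_eq0.
  move=> /allP uj; apply/colP => j; rewrite mxE; apply/eqP.
  by have := uj j (mem_index_enum j); rewrite -expr2 sqrf_eq0.
by move=> j _; rewrite -expr2 sqr_ge0.
Qed.

Lemma enorm_gt0 u : u != 0 -> 0 < enorm u.
Proof.
by move=> u0; rewrite lt_def enorm_ge0 andbT; apply: contra_neq u0 => /enorm0_eq0.
Qed.

Lemma enormZ c u : enorm (c *: u) = `|c| * enorm u.
Proof.
by rewrite !enormE dotvZl dotvZr mulrA -expr2 sqrtrM ?sqr_ge0// sqrtr_sqr.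
Qed.

Lemma enormN u : enorm (- u) = enorm u.
Proof. by rewrite -scaleN1r enormZ normrN1 mul1r. Qed.

Lemma enorm0 : enorm (0 : 'cV[R]_n) = 0.
Proof. by rewrite -(scale0r (0 : 'cV[R]_n)) enormZ normr0 mul0r. Qed.

(** Cauchy-Schwarz: expand the square of |v| u - |u| v. *)
Lemma dotv_le_enorm u v : dotv u v <= enorm u * enorm v.
Proof.
have [->|/enorm_gt0 u0] := eqVneq u 0.
  by rewrite enorm0 mul0r -(scale0r (0 : 'cV[R]_n)) dotvZl mul0r.
have [->|/enorm_gt0 v0] := eqVneq v 0.
  by rewrite enorm0 mulr0 -(scale0r (0 : 'cV[R]_n)) dotvZr mul0r.
have := dotvv_ge0 (enorm v *: u - enorm u *: v).
rewrite dotvBr -scaleNr !dotvDl !dotvZr !dotvZl -!sqr_enorm (dotvC v u).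
set p := dotv u v; have uv0 : 0 < enorm u * enorm v by exact: mulr_gt0.
by move=> h; rewrite -(ler_pM2l uv0); nra.
Qed.

Lemma dotv_ge_enorm u v : - (enorm u * enorm v) <= dotv u v.
Proof.
by have := dotv_le_enorm u (- v); rewrite dotvNr enormN lerNl.
Qed.

Lemma ler_enormD u v : enorm (u + v) <= enorm u + enorm v.
Proof.
rewrite -(@ler_pXn2r _ 2)// ?nnegrE ?addr_ge0 ?enorm_ge0//.
rewrite sqr_enorm dotvDl !dotvDr -!sqr_enorm (dotvC v u).
by have := dotv_le_enorm u v; lra.
Qed.

(** The Frobenius norm bounds the spectral norm, which makes the set in
    [specnorm] bounded, so that its [sup] is an upper bound. *)
Lemma enorm_mulmx_le A v :
  enorm (A *m v) <= Num.sqrt (\sum_(i < n) \sum_(j < n) A i j ^+ 2) * enorm v.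
Proof.
have A0 : 0 <= \sum_(i < n) \sum_(j < n) A i j ^+ 2.
  by apply: sumr_ge0 => i _; apply: sumr_ge0 => j _; rewrite sqr_ge0.
rewrite -(@ler_pXn2r _ 2)// ?nnegrE ?mulr_ge0 ?enorm_ge0 ?sqrtr_ge0//.
rewrite exprMn (sqr_sqrtr A0) [leLHS]sqr_enorm /dotv.
rewrite mulr_suml; apply: ler_sum => i _.
pose r : 'cV[R]_n := \col_j A i j.
have -> : (A *m v) i 0 = dotv r v.
  by rewrite mxE; apply: eq_bigr => j _; rewrite mxE.
have -> : \sum_(j < n) A i j ^+ 2 = enorm r ^+ 2.
  by rewrite sqr_enorm; apply: eq_bigr => j _; rewrite mxE expr2.
rewrite -exprMn -expr2 -[leLHS]real_normK ?num_real// ler_pXn2r ?nnegrE ?mulr_ge0 ?enorm_ge0//.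
by rewrite ler_norml dotv_ge_enorm dotv_le_enorm.
Qed.

Lemma enorm_mulmx_specnorm A v : enorm (A *m v) <= specnorm A * enorm v.
Proof.
have [->|v0] := eqVneq v 0; first by rewrite mulmx0 enorm0 mulr0.
have nv := enorm_gt0 v0.
rewrite -ler_pdivrMr// mulrC; apply: ub_le_sup; last first.
  exists ((enorm v)^-1 *: v); rewrite /= -?scalemxAr enormZ ger0_norm ?invr_ge0 ?enorm_ge0//.
  by rewrite mulVf// lt0r_neq0.
exists (Num.sqrt (\sum_(i < n) \sum_(j < n) A i j ^+ 2)) => _ [w /= w1 <-].
apply: le_trans (enorm_mulmx_le A w) _.
by rewrite ler_piMr// sqrtr_ge0.
Qed.

End Euclidean.

(** * First- and second-order bounds for a convex function *)

Section Calculus.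
Variables (R : realType) (n : nat) (f : 'cV[R]_n -> R).
Implicit Types (x y d : 'cV[R]_n) (t H : R).

Lemma derive_grad x d : differentiable f x -> 'D_d f x = dotv (grad f x) d.
Proof.
move=> df; rewrite deriveE// {1}(matrix_sum_delta d) linear_sum; apply: eq_bigr => i _.
by rewrite big_ord1 linearZ/= mxE deriveE// mulrC.
Qed.

Lemma is_derive_line x d t : differentiable f (x + t *: d) ->
  is_derive t 1 (fun s => f (x + s *: d)) (dotv (grad f (x + t *: d)) d).
Proof.
move=> df; have fd := diff_derivable df (v := d).
have e : (fun h : R => h^-1 *: (((fun s => f (x + s *: d)) \o shift t) (h *: 1)
                                - f (x + t *: d))) =
         (fun h : R => h^-1 *: ((f \o shift (x + t *: d)) (h *: d) - f (x + t *: d))).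
  apply/funext => h /=; congr (_ *: (f _ - _)).
  by rewrite [h *: 1]mulr1 scalerDl addrCA.
apply: DeriveDef; first by rewrite /derivable e; exact: fd.
by rewrite /derive e -derive_grad.
Qed.

(** The difference quotient of [f] at [x] towards [y] is at most [f y - f x] for
    steps in (0, 1]; pass to the limit from the right. *)
Lemma convex_ge_tangent x y : convex_on_space f -> differentiable f x ->
  f x + dotv (grad f x) (y - x) <= f y.
Proof.
move=> cf df; rewrite -lerBrDl -derive_grad//.
have := cvg_dnbhs_at_right (diff_derivable df (v := y - x)).
move=> c; rewrite /derive -(cvg_lim _ c)//; apply: limr_le; first by apply: cvgP c.
near=> h.
have h0 : 0 < h by near: h; exact: nbhs_right_gt.
have h1 : h <= 1 by near: h; exact: nbhs_right_le.
have hi : 0 <= h <= 1 by rewrite (ltW h0).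
(* [h] weighs [y] and [1 - h] weighs [x] in the convex combination. *)
have := cf (Itv01 (ltW h0) h1) y x (in_setT _) (in_setT _).
rewrite convRE /= /conv /=.
have -> : h *: y + unstable.onem h *: x = h *: (y - x) + x.
  by rewrite /unstable.onem scalerBl scale1r scalerBr; rewrite addrA addrAC.
move=> cfh; rewrite /= [leLHS]mulrC ler_pdivrMr// -lerBDr.
by move: cfh; rewrite /unstable.onem; lra.
Unshelve. all: by end_near. Qed.

(** The form in which the Hessian bound is used: along a line, the derivative
    of [f] is affine up to a quadratic error. *)
Lemma grad_line_remainder H x d t :
  (forall z, enorm (grad f z - grad f x - hess f x *m (z - x))
               <= H * enorm (z - x) ^+ 2) ->
  `|dotv (grad f (x + t *: d)) d - dotv (grad f x) d
     - t * dotv d (hess f x *m d)| <= t ^+ 2 * (H * enorm d ^+ 3).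
Proof.
move=> /(_ (x + t *: d)); have -> : x + t *: d - x = t *: d by rewrite addrAC subrr add0r.
rewrite -scalemxAr enormZ; set e := grad f (x + t *: d) - _ - _ => e_le.
have -> : dotv (grad f (x + t *: d)) d - dotv (grad f x) d
            - t * dotv d (hess f x *m d) = dotv e d.
  by rewrite /e !dotvDl !dotvNl !dotvZl (dotvC d).
have /le_trans -> // : `|dotv e d| <= enorm e * enorm d.
  by rewrite ler_norml dotv_ge_enorm dotv_le_enorm.
have -> : t ^+ 2 * (H * enorm d ^+ 3) = H * (`|t| * enorm d) ^+ 2 * enorm d.
  by rewrite exprMn real_normK ?num_real//; ring.
by rewrite ler_wpM2r ?enorm_ge0.
Qed.

(** The gradient of a convex function is monotone; along [x + t d] the
    remainder bound turns this into [- t H |d|^3 <= d^T hess d] for every t > 0,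
    and t tends to 0. *)
Lemma hess_psd H x d : 0 <= H -> convex_on_space f ->
  (forall y, differentiable f y) ->
  (forall z, enorm (grad f z - grad f x - hess f x *m (z - x))
               <= H * enorm (z - x) ^+ 2) ->
  0 <= dotv d (hess f x *m d).
Proof.
move=> H0 cf df fh; set q := dotv _ _; rewrite leNgt; apply/negP => q0.
set K := H * enorm d ^+ 3.
have K0 : 0 <= K by rewrite mulr_ge0// exprn_ge0 ?enorm_ge0.
have mono t : 0 < t -> - (t * K) <= q.
  move=> t0; have := convex_ge_tangent (x + t *: d) cf (df x).
  have := convex_ge_tangent x cf (df (x + t *: d)).
  have -> : x + t *: d - x = t *: d by rewrite addrAC subrr add0r.
  have -> : x - (x + t *: d) = - (t *: d) by rewrite opprD addrA subrr add0r.
  rewrite dotvNr !dotvZr => c1 c2.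
  have le_ab : dotv (grad f x) d <= dotv (grad f (x + t *: d)) d.
    by rewrite -(ler_pM2l t0); lra.
  have := grad_line_remainder d t fh; rewrite ler_norml -/q -/K => /andP[_ r].
  by rewrite -(ler_pM2l t0) mulrN mulrA -expr2; lra.
(* This t makes t K smaller than - q / 2; the + 1 covers K = 0. *)
have K1 : 0 < 2 * (K + 1) by lra.
have t0 : 0 < - q / (2 * (K + 1)) by rewrite divr_gt0// oppr_gt0.
have := mono _ t0; apply/negP; rewrite -ltNge ltrNr mulrAC ltr_pdivrMr//.
by nra.
Qed.

(** [phi] subtracts from [f (x + t d)] its quadratic model and the integrated
    remainder H t^3 |d|^3 / 3; its derivative is nonpositive, so the mean value
    theorem gives [phi 1 <= phi 0].  The constant 1/3 from the integration is
    the one that appears in [sigma_hat2]. *)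
Lemma taylor_quadratic_le H x d : (forall y, differentiable f y) ->
  (forall z, enorm (grad f z - grad f x - hess f x *m (z - x))
               <= H * enorm (z - x) ^+ 2) ->
  f (x + d) <= f x + dotv (grad f x) d + dotv d (hess f x *m d) / 2
                 + H / 3 * enorm d ^+ 3.
Proof.
move=> df fh; set b := dotv _ d; set q := dotv d _; set D := enorm d.
pose g (s : R) : R := f (x + s *: d).
pose phi : R -> R := g - (b \*: (@id R) + (q / 2) \*: (@id R) ^+ 2
                          + (H / 3 * D ^+ 3) \*: (@id R) ^+ 3).
pose dphi (s : R) : R := dotv (grad f (x + s *: d)) d - b - s * q - s ^+ 2 * (H * D ^+ 3).
have phi_d (s : R) : is_derive s 1 phi (dphi s).
  have dg : is_derive s 1 g _ := is_derive_line (df (x + s *: d)).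
  rewrite /phi; apply: is_derive_eq.
  by rewrite /dphi /= /GRing.scale/=; field.
have phi_c : {within `[0, 1], continuous phi}.
  apply: continuous_subspaceT => u; apply: differentiable_continuous.
  by apply/derivable1_diffP; exact: ex_derive.
have [c _] := MVT ltr01 (fun u _ => phi_d u) phi_c.
have dphi_le0 : dphi c <= 0.
  by have := grad_line_remainder d c fh; rewrite ler_norml /dphi subr_le0 => /andP[].
rewrite subr0 mulr1 => phi01; move: dphi_le0; rewrite -phi01 /phi/= !fctE /g /=.
rewrite scale1r scale0r addr0 /GRing.scale/=; lra.
Qed.

End Calculus.

(** * The threshold on the trial value *)

Section Scalar.
Variable R : realType.
Implicit Types (alpha zeta kappa H g T : R).

(** [sigma_hat2] is t^2 for the nonnegative root t of w t^2 - kappa t = P / 3,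
    with w = 1/2 - 1/zeta and P = H g^(1-alpha).  If T = rho t with rho^2 >= 2,
    then w T^2 - kappa T >= rho^2 (w t^2 - kappa t), because rho <= rho^2. *)
Lemma sigma_hat2_threshold alpha zeta kappa H g T :
  2 < zeta -> 0 <= kappa -> 0 <= H -> 0 <= T ->
  2 * sigma_hat2 alpha zeta kappa H g <= T ^+ 2 ->
  let e := (1 / 2 - 1 / zeta) * T - kappa in
  0 <= e /\ 2 / 3 * (H * g `^ (1 - alpha)) <= e * T.
Proof.
move=> zeta2 kappa0 H0 T0; rewrite /sigma_hat2.
set P := H * _; set w := 1 / 2 - 1 / zeta.
have zi : 0 < zeta^-1 < 1 / 2.
  have zeta0 : 0 < zeta by lra.
  by rewrite invr_gt0 zeta0 div1r ltf_pV2 ?posrE.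
have w0 : 0 < w by rewrite /w; lra.
have P0 : 0 <= P by rewrite mulr_ge0// powR_ge0.
have Pw0 : 0 <= 4 * P * w / 3 by have := mulr_ge0 P0 (ltW w0); lra.
have -> : 1 - 2 / zeta = 2 * w by rewrite /w; lra.
have -> : 4 * H / 3 * g `^ (1 - alpha) * w = 4 * P * w / 3 by rewrite /P; ring.
set r := Num.sqrt _; set t := (kappa + r) / (2 * w).
have r0 : 0 <= r by exact: sqrtr_ge0.
have r2 : r ^+ 2 = kappa ^+ 2 + 4 * P * w / 3.
  by rewrite sqr_sqrtr// addr_ge0 ?sqr_ge0.
have t0 : 0 <= t by rewrite divr_ge0 ?addr_ge0//; lra.
have tr : 2 * w * t = kappa + r by rewrite mulrC divfK// gt_eqF// mulr_gt0.
have root_t : w * t ^+ 2 - kappa * t = P / 3.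
  apply: (@mulfI _ (4 * w)); first by rewrite gt_eqF// mulr_gt0.
  have -> : 4 * w * (w * t ^+ 2 - kappa * t)
            = (2 * w * t) ^+ 2 - 2 * kappa * (2 * w * t) by ring.
  by rewrite tr; have := r2; lra.
move=> T2 /=.
have tT : t <= T by rewrite -(@ler_pXn2r _ 2)// ?nnegrE//; have := sqr_ge0 t; lra.
have wtk : kappa <= w * t.
  have : kappa <= r by rewrite -(@ler_pXn2r _ 2)// ?nnegrE// r2 lerDl.
  lra.
have wtT : w * t <= w * T by rewrite ler_pM2l.
split; first lra.
(* The scaling argument divides by t, which vanishes when kappa = P = 0. *)
have [t_eq0|tp] : t = 0 \/ 0 < t by case: (ltgtP t 0) t0; auto.
  move: root_t; rewrite t_eq0 => root0; have PE : P = 0 by lra.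
  by rewrite PE mulr0 mulr_ge0//; lra.
nra.
Qed.

(** With e = w T - kappa, monotonicity in lambda gives E >= a e and
    Delta >= a (e + T/2).  Then e (e + T/2) >= P / 3 is immediate from
    e T >= 2 P / 3, and (e + T/2)^2 >= 2 e T >= P because
    (e + T/2)^2 - 2 e T = (e - T/2)^2.  Both conclusions follow by comparing with
    H D Delta <= H G <= P a^2 and cancelling Delta. *)
Lemma step_length_small (w kappa a T lam H G D P : R) :
  0 <= w -> 0 < a -> 0 < H -> 0 < G -> 0 <= T -> a * T <= lam ->
  0 <= w * T - kappa -> 2 / 3 * P <= (w * T - kappa) * T ->
  H * G <= P * a ^+ 2 ->
  D * ((w * lam - kappa * a) + lam / 2) <= G ->
  H * D <= (w * lam - kappa * a) + lam / 2 /\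
  H * D / 3 <= w * lam - kappa * a.
Proof.
set e := w * T - kappa => w0 a0 H0 G0 T0 lamT e0 eT HG DG.
set E := w * lam - kappa * a in DG *; set Del := E + lam / 2 in DG *.
have Ee : a * e <= E.
  have := ler_wpM2l w0 lamT; rewrite /E /e; lra.
have DelE : a * (e + T / 2) <= Del by rewrite /Del; lra.
have P0 : 0 < P.
  by rewrite -(pmulr_lgt0 _ (exprn_gt0 2 a0)); apply: lt_le_trans HG; exact: mulr_gt0.
have T1 : 0 < T by rewrite lt_def T0 andbT; apply/eqP => T00; move: eT; rewrite T00; lra.
have b0 : 0 < a * (e + T / 2) by rewrite mulr_gt0//; lra.
have Del0 : 0 < Del by lra.
have ae0 : 0 <= a * e by rewrite mulr_ge0// ltW.
have a2 : 0 < a ^+ 2 by rewrite exprn_gt0.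
have DelDel : (a * (e + T / 2)) ^+ 2 <= Del ^+ 2.
  by rewrite ler_pXn2r// nnegrE; lra.
have EDel : (a * e) * (a * (e + T / 2)) <= E * Del by apply: ler_pM => //; lra.
have HDG : H * D * Del <= H * G by rewrite -mulrA ler_pM2l.
split; rewrite -(ler_pM2r Del0).
- apply: le_trans HDG _; apply: le_trans HG _; rewrite -expr2.
  apply: le_trans DelDel; rewrite exprMn mulrC ler_pM2l//.
  by have := sqr_ge0 (e - T / 2); lra.
- apply: le_trans EDel.
  have -> : a * e * (a * (e + T / 2)) = a ^+ 2 * (e * (e + T / 2)) by ring.
  have : a ^+ 2 * (P / 3) <= a ^+ 2 * (e * (e + T / 2)).
    by rewrite ler_pM2l//; have := sqr_ge0 e; lra.
  lra.
Qed.

End Scalar.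

(** * One inexact regularized Newton step *)

Section InexactStep.
Variables (R : realType) (n : nat) (f : 'cV[R]_n -> R) (H : R).
Variables (x d : 'cV[R]_n) (B : 'M[R]_n) (lam theta mu : R).
Hypothesis lam_ge0 : 0 <= lam.
Hypothesis f_diff : forall y, differentiable f y.
Hypothesis f_hess : forall z,
  enorm (grad f z - grad f x - hess f x *m (z - x)) <= H * enorm (z - x) ^+ 2.
Hypothesis B_hess : enorm ((B - hess f x) *m d) <= mu * enorm d.
Hypothesis step_d :
  enorm ((B + lam%:M) *m d + grad f x) <= theta * enorm d.

Let r := (B + lam%:M) *m d + grad f x.

Let gradE : grad f x = r - (B - hess f x) *m d - hess f x *m d - lam *: d.
Proof.
rewrite /r mulmxDl mul_scalar_mx mulmxBl; apply/colP => i; rewrite !mxE; ring.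
Qed.

(** The step equation tested against [d], common to the length and decrease
    estimates. *)
Let dotv_grad_le :
  dotv (grad f x) d <= - (lam - theta - mu) * enorm d ^+ 2 - dotv d (hess f x *m d).
Proof.
rewrite dotvC gradE !dotvBr dotvZr -sqr_enorm.
have h1 : dotv d r <= theta * enorm d ^+ 2.
  apply: le_trans (dotv_le_enorm _ _) _.
  by rewrite mulrC expr2 mulrA ler_wpM2r ?enorm_ge0.
have h2 : - (mu * enorm d ^+ 2) <= dotv d ((B - hess f x) *m d).
  apply: le_trans (dotv_ge_enorm _ _); rewrite lerN2 mulrC expr2 mulrA.
  by rewrite ler_wpM2r ?enorm_ge0.
lra.
Qed.

(** Pair the defining equation of the step with [d]: the Hessian contributes a
    nonnegative term, the error of [B] and the residual at most
    (mu + theta) |d|^2. *)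
Lemma inexact_step_length : 0 <= dotv d (hess f x *m d) ->
  (lam - theta - mu) * enorm d <= enorm (grad f x).
Proof.
move=> psd; have [d0|d0] := eqVneq d 0; first by rewrite d0 enorm0 mulr0 enorm_ge0.
rewrite -(ler_pM2r (enorm_gt0 d0)) -mulrA -expr2.
by have := dotv_ge_enorm (grad f x) d; have := dotv_grad_le; lra.
Qed.

(** Substituting the step equation into the Taylor bound, the linear term
    produces - d^T hess d, which absorbs the + d^T hess d / 2. *)
Lemma inexact_step_decrease : 0 <= dotv d (hess f x *m d) ->
  f (x + d) <= f x - (lam - theta - mu - H * enorm d / 3) * enorm d ^+ 2.
Proof.
move=> psd; apply: le_trans (taylor_quadratic_le d f_diff f_hess) _.
have := dotv_grad_le; rewrite mulrBl.
have -> : H * enorm d / 3 * enorm d ^+ 2 = H / 3 * enorm d ^+ 3 by ring.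
lra.
Qed.

(** The Hessian term of the Taylor expansion of the gradient cancels the one
    in the step equation, leaving only the error terms and lambda d. *)
Lemma inexact_step_grad :
  enorm (grad f (x + d)) <= (lam + theta + mu + H * enorm d) * enorm d.
Proof.
have := f_hess (x + d); have -> : x + d - x = d by rewrite addrAC subrr add0r.
set e := _ - _ - _ => e_le.
have -> : grad f (x + d) = e + (r + (- ((B - hess f x) *m d) - lam *: d)).
  rewrite /e [in RHS]gradE; apply/colP => i; rewrite !mxE; ring.
apply: le_trans (ler_enormD _ _) _.
have := ler_enormD r (- ((B - hess f x) *m d) - lam *: d).
have := ler_enormD (- ((B - hess f x) *m d)) (- (lam *: d)).
rewrite !enormN enormZ ger0_norm//.
have := B_hess; have := step_d; rewrite -/r.
by move: e_le; rewrite expr2 mulrA; lra.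
Qed.

End InexactStep.
Section Trial.
Variables (R : realType) (n : nat) (f : 'cV[R]_n -> R).
Variables (H alpha theta zeta kappaB M : R).
Hypothesis f_convex : convex_on_space f.
Hypothesis f_diff : forall y, differentiable f y.
Hypothesis H_gt0 : 0 < H.
Hypothesis f_hess : forall y z : 'cV[R]_n,
  enorm (grad f z - grad f y - hess f y *m (z - y)) <= H * enorm (z - y) ^+ 2.
Hypothesis alpha_range : 0 < alpha <= 1.
Hypothesis theta_ge0 : 0 <= theta.
Hypothesis zeta_gt2 : 2 < zeta.
Hypothesis kappaB_ge0 : 0 <= kappaB.

(** The factor [2 (1 + theta)]^(alpha/2) is at least 1. *)
Lemma trial_lambda_ge (x : 'cV[R]_n) (s : R) : 0 <= s ->
  Num.sqrt (enorm (grad f x) `^ alpha) * Num.sqrt s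
    <= trial_lambda f alpha theta zeta x s.
Proof.
have [alpha0 _] := andP alpha_range; move=> s0; rewrite /trial_lambda le_max; apply/orP; left.
have base_ge1 : 1 <= 2 * (1 + theta) by have := theta_ge0; lra.
rewrite mulrC -sqrtrM// ler_peMl ?sqrtr_ge0//.
rewrite -[leLHS](powRr0 (2 * (1 + theta))); by apply: ler_powR; rewrite // divr_ge0// ltW.
Qed.

Lemma trial_acceptable (x xp : 'cV[R]_n) (s : R) :
  grad f x != 0 -> enorm (grad f x) <= M -> 0 <= s ->
  2 * sigma_hat2 alpha zeta kappaB H M <= s ->
  specnorm (trial_B f alpha kappaB x s - hess f x)
    <= kappaB * Num.sqrt (enorm (grad f x) `^ alpha) ->
  inexact_step f alpha theta zeta kappaB x s xp ->
  acceptable f alpha theta zeta x s xp.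
Proof.
move=> g0 gM s0 s_ge B_hess; rewrite /inexact_step /acceptable.
have := trial_lambda_ge x s0.
set lam := trial_lambda f alpha theta zeta x s; set B := trial_B _ _ _ _ _ in B_hess *.
set G := enorm (grad f x) in gM B_hess *.
set a := Num.sqrt (G `^ alpha) in B_hess *.
set T := Num.sqrt s => lamT step.
have G0 : 0 < G by exact: enorm_gt0.
have a0 : 0 < a by rewrite sqrtr_gt0 powR_gt0.
have T0 : 0 <= T by exact: sqrtr_ge0.
have [alpha0 alpha1] := andP alpha_range.
have lam_zeta : theta <= lam / zeta.
  by rewrite ler_pdivlMr 1?mulrC; [rewrite /lam /trial_lambda le_max lexx orbT|have := zeta_gt2; lra].
have [e0 eT] : let e := (1 / 2 - 1 / zeta) * T - kappaB in
    0 <= e /\ 2 / 3 * (H * M `^ (1 - alpha)) <= e * T.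
  by apply: sigma_hat2_threshold; rewrite // ?sqr_sqrtr// ltW.
have w0 : 0 <= 1 / 2 - 1 / zeta.
  have zeta0 : 0 < zeta by have := zeta_gt2; lra.
  by rewrite subr_ge0 !div1r lef_pV2 ?posrE// ltW.
(* G = G^(1-alpha) a^2, and the exponent 1 - alpha is nonnegative, so G <= M
   can be used on the first factor. *)
have HG : H * G <= H * M `^ (1 - alpha) * a ^+ 2.
  rewrite sqr_sqrtr ?powR_ge0// -mulrA ler_pM2l//.
  have {1}-> : G = G `^ (1 - alpha) * G `^ alpha.
    by rewrite -powRD ?subrK ?powRr1 ?ltW// oner_eq0.
  rewrite ler_wpM2r ?powR_ge0//.
  by apply: ge0_ler_powR; rewrite ?nnegrE; lra.
set d := xp - x in step *; have -> : xp = x + d by rewrite addrC subrK.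
have psd : 0 <= dotv d (hess f x *m d).
  exact: (hess_psd d (ltW H_gt0) f_convex f_diff (f_hess x)).
have Bd : enorm ((B - hess f x) *m d) <= kappaB * a * enorm d.
  by apply: le_trans (enorm_mulmx_specnorm _ _) _; rewrite ler_wpM2r ?enorm_ge0.
have stepd : enorm ((B + lam%:M) *m d + grad f x) <= theta * enorm d.
  apply: le_trans step _; rewrite ler_wpM2l//.
  by rewrite ge_min lexx orbT.
have lam0 : 0 <= lam by apply: le_trans lamT; rewrite mulr_ge0// ltW.
have D0 := enorm_ge0 d.
have len := inexact_step_length Bd stepd psd.
have DG : enorm d * (((1 / 2 - 1 / zeta) * lam - kappaB * a) + lam / 2) <= G.
  apply: le_trans len; rewrite mulrC ler_wpM2r//; lra.
have [HD1 HD2] := step_length_small w0 a0 H_gt0 G0 T0 lamT e0 eT HG DG.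
apply/andP; split.
- apply: le_trans (inexact_step_decrease f_diff (f_hess x) Bd stepd psd) _.
  rewrite lerD2l lerN2 ler_wpM2r ?sqr_ge0//; lra.
- apply: le_trans (inexact_step_grad lam0 (f_hess x) Bd stepd) _.
  rewrite ler_wpM2r//; lra.
Qed.

End Trial.

Theorem corollary4p1 (R : realType) (n : nat) (f : 'cV[R]_n -> R) (H : R)
    (alpha theta zeta kappaB : R) (x1 : 'cV[R]_n) (sigma1 : R)
    (N : option nat) (x : nat -> 'cV[R]_n) (sigma : nat -> R)
    (i0 ik : nat -> nat) (xp : nat -> nat -> 'cV[R]_n) (M : R)
  (f_convex : convex_on_space f)
  (f_diff2 : twice_differentiable f)
  (H_gt0 : 0 < H)
  (f_hess : forall y z : 'cV[R]_n,
    enorm (grad f z - grad f y - hess f y *m (z - y)) <= H * enorm (z - y) ^+ 2)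
  (f_sublevel : forall z : 'cV[R]_n, bounded_set (sublevel f z))
  (sigma1_gt0 : 0 < sigma1)
  (alpha_range : 0 < alpha <= 1)
  (theta_range : 0 < theta < 1)
  (zeta_gt2 : 2 < zeta)
  (kappaB_gt0 : 0 < kappaB)
  (run : algorithm1_run f alpha theta zeta kappaB x1 sigma1 N x sigma i0 ik xp)
  (B_bound : forall k i, performed N k -> (i0 k <= i <= ik k)%N ->
    specnorm (trial_B f alpha kappaB (x k) (2 ^+ i * sigma k) - hess f (x k))
      <= kappaB * Num.sqrt (enorm (grad f (x k)) `^ alpha))
  (M_gt0 : 0 < M)
  (M_bound : forall y, sublevel f x1 y -> enorm (grad f y) <= M) :
  forall k, generated N k ->
    sigma1 <= sigma k <=
      2 * Num.max (4 * kappaB ^+ 2)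
            (Num.max (sigma_hat1 alpha zeta kappaB H M)
                     (sigma_hat2 alpha zeta kappaB H M)) + sigma1.
Proof.
set smax := 2 * _ + _.
have [theta0 _] := andP theta_range.
have smax_hat2 : 2 * sigma_hat2 alpha zeta kappaB H M + sigma1 <= smax.
  by rewrite lerD2r ler_pM2l// !le_max lexx !orbT.
have smax_sigma1 : sigma1 <= smax.
  by apply: le_trans smax_hat2; rewrite lerDr mulr_ge0// sqr_ge0.
(* Membership in L(x_1) is carried along because it gives the bound M. *)
suff inv k : generated N k -> sublevel f x1 (x k) /\ sigma1 <= sigma k <= smax.
  by move=> k /inv[].
elim: k => // -[_ _|k IHk gen].
  by rewrite (run_x1 run) (run_sigma1 run) /sublevel/= !lexx.
have perf : performed N k.+1 by [].
have genk : generated N k.+1.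
  by move: gen; rewrite /generated; case: (N) => //= m; exact: ltnW.
have [xk /andP[sk_ge sk_le]] := IHk genk.
have it := run_iteration run perf; set K := k.+1 in perf genk xk sk_ge sk_le it *.
have sk0 : 0 < sigma K by exact: lt_le_trans sk_ge.
have sigma_next : 2 * sigma K.+1 = 2 ^+ ik K * sigma K.
  rewrite (iter_sigma it) expfzDr ?pnatr_eq0// exprN1 -exprnP.
  by rewrite [_ / 2]mulrC mulrA mulVKf ?pnatr_eq0.
split.
  rewrite (iter_next it) /sublevel/=.
  have /andP[dec _] := iter_accept it.
  apply: le_trans dec _; apply: le_trans xk.
  rewrite gerBl mulr_ge0 ?sqr_ge0// divr_ge0// le_max.
  by apply/orP; right; rewrite mulr_ge0//; lra.
apply/andP; split.
  rewrite -(ler_pM2l (ltr0Sn R 1)) sigma_next.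
  apply: le_trans (iter_start it) _; rewrite ler_pM2r//.
  by rewrite ler_weXn2l ?ler1n//; exact: iter_start_le it.
(* Either the first trial is accepted, or index [ik K - 1] was rejected. *)
have := iter_start_le it; rewrite leq_eqVlt => /predU1P[i0ik|lt_i0ik].
  have ik_le1 : (ik K <= 1)%N.
    rewrite -i0ik leqNgt; apply/negP => i0_gt1.
    by have := iter_start_least it i0_gt1; rewrite expr1 ltr_pM2l// ltNge sk_ge.
  apply: le_trans sk_le; rewrite -(ler_pM2l (ltr0Sn R 1)) sigma_next ler_pM2r//.
  by rewrite -[leRHS]expr1 ler_weXn2l ?ler1n.
have [i ikE] : exists i, ik K = i.+1 by exists (ik K).-1; rewrite (ltn_predK lt_i0ik).
have le_i : (i0 K <= i < ik K)%N by rewrite ikE ltnSn andbT -ltnS -ikE.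
have le_i' : (i0 K <= i <= ik K)%N by case/andP: le_i => -> /ltnW ->.
have -> : sigma K.+1 = 2 ^+ i * sigma K.
  by apply: (@mulfI _ 2); rewrite // sigma_next ikE exprS mulrA.
rewrite leNgt; apply: contra (iter_reject it le_i) => s_gt.
apply: (trial_acceptable (H := H) (kappaB := kappaB) (M := M)) => //.
- by case: f_diff2.
- exact: ltW.
- exact: ltW.
- exact: iter_nonstationary it.
- exact: M_bound.
- by rewrite mulr_ge0// ltW.
- by apply: ltW; apply: le_lt_trans s_gt; apply: le_trans smax_hat2; rewrite lerDl ltW.
- exact: B_bound.
- exact: iter_trial it _ le_i'.
Qed.
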